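(* Let $$a=78771396447102712858983060028364040588200363965800348300294278460171184936676238386812500,$$ $$b=69361450337373409253643736115520077769719726556245843055209221317850552454692640951093751$$ (decimal notation). Then $d(a,b)=6$.
   Context: Let $\mathbb{N}=\{1,2,\ldots\}$. $G$ is the undirected simple graph with vertex set $\mathbb{N}$ in which $x\sim y$ if and only if $|x-y|=1$ or $\max\{x,y\}/\min\{x,y\}$ is a prime number. $d(x,y)$ denotes graph distance in $G$. Each integer is the concatenation of two lines of decimal digits, in order: for $a$ the lines are 787713964471027128589830600283640405882003639658 and 00348300294278460171184936676238386812500; for $b$ the lines are 693614503373734092536437361155200777697197265562 and 45843055209221317850552454692640951093751. *)

(* Defs.v *)
From Stdlib Require Import ZArith Znumtheory Lia.

Record simple_graph (V : Type) : Type := SimpleGraph {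
  adj : V -> V -> Prop;
  adj_sym : forall x y : V, adj x y -> adj y x;
  adj_irrefl : forall x : V, ~ adj x x
}.

Arguments adj {V}.

(* [walk g x y n]: there is a walk with exactly [n] edges from [x] to [y]. *)
Inductive walk {V : Type} (g : simple_graph V) : V -> V -> nat -> Prop :=
| walk_nil : forall x : V, walk g x x 0
| walk_cons : forall (x y z : V) (n : nat),
    adj g x y -> walk g y z n -> walk g x z (S n).

(* The distance is a relation because [g] need not be connected: no [n]
   satisfies it when [x] and [y] lie in different components. *)
Definition is_dist {V : Type} (g : simple_graph V) (x y : V) (n : nat) : Prop :=
  walk g x y n /\ forall m : nat, walk g x y m -> (n <= m)%nat.

(* The vertex set {1, 2, ...} is [positive]. The quotient max/min is an exact
   one, so "max/min is the prime p" reads max = p * min. *)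
Definition adjG (x y : positive) : Prop :=
  Z.abs (Z.pos x - Z.pos y) = 1%Z \/
  exists p : Z, prime p /\ Z.pos (Pos.max x y) = (p * Z.pos (Pos.min x y))%Z.

Lemma adjG_sym (x y : positive) : adjG x y -> adjG y x.
Proof.
  unfold adjG; rewrite (Pos.max_comm y x), (Pos.min_comm y x).
  intros [H | H]; [left; lia | right; exact H].
Qed.

Lemma adjG_irrefl (x : positive) : ~ adjG x x.
Proof.
  unfold adjG; rewrite Pos.max_id, Pos.min_id.
  intros [H | [p [[Hp _] H]]]; [lia | nia].
Qed.

Definition G : simple_graph positive := SimpleGraph positive adjG adjG_sym adjG_irrefl.

Definition a : positive :=
  78771396447102712858983060028364040588200363965800348300294278460171184936676238386812500.

Definition b : positive :=
  69361450337373409253643736115520077769719726556245843055209221317850552454692640951093751.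

(* Main.v *)
(** Lower bound: split a walk of length at most 5 into [t] multiplicative steps
    (by a prime, or its inverse) and [s] additive steps. A multiplicative step
    lowers a valuation by at most one, and [a + i], [b + k] for small [i], [k]
    were built to be divisible by cubes or higher powers of many small primes, so
    a run of multiplicative steps keeps divisibilities that contradict an
    additive step in between. The longest argument is [t = 3], [s = 2] with
    alternating steps: since [4] divides [a], [b] is odd and [17 ^ 3] divides
    both, the last vertex before [b] must be [2 * b], and [61 ^ 3], [67 ^ 3]
    divide both [a] and [2 * b - 1], [2 * b + 1] respectively. For [s >= 3] at most two
    multiplicative steps remain, and size or a common cube rules them out.

    Upper bound: an explicit walk whose three multipliers are proved prime by
    Pocklington's criterion to the base [2]. *)

Require Import Defs.
From Stdlib Require Import ZArith Znumtheory.
From Stdlib Require Import Zpow_facts Lia List.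
From mathcomp Require ssreflect ssrbool eqtype ssrnat div prime binomial.
Import ListNotations.
Open Scope Z_scope.

(** * Fermat's little theorem over the integers, transferred from the naturals *)

Lemma prime_to_nat p : prime p -> prime.prime (Z.to_nat p) = true.
Proof.
  intros Hp; assert (H2 := prime_ge_2 _ Hp).
  apply (ssrbool.introT prime.primeP); split.
  - apply (ssrbool.introT ssrnat.leP); lia.
  - intros d D; destruct (ssrbool.elimT div.dvdnP D) as [k E].
    change (ssrnat.muln k d) with (k * d)%nat in E.
    assert (Dz : (Z.of_nat d | p)) by (exists (Z.of_nat k); lia).
    apply prime_divisors in Dz; [| exact Hp].
    assert (C : d = 1%nat \/ d = Z.to_nat p) by lia.
    apply Bool.orb_true_iff; destruct C as [-> | ->]; [left | right];
      apply eqtype.eq_refl.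
Qed.

Lemma fermat_little_Z p c : prime p -> 0 <= c -> (p | c ^ p - c).
Proof.
  intros Hp Hc; assert (H2 := prime_ge_2 _ Hp).
  assert (F := binomial.fermat_little (Z.to_nat c) (prime_to_nat p Hp)).
  assert (E1 := div.divn_eq (ssrnat.expn (Z.to_nat c) (Z.to_nat p)) (Z.to_nat p)).
  assert (E2 := div.divn_eq (Z.to_nat c) (Z.to_nat p)).
  assert (E3 : forall n, Z.of_nat (ssrnat.expn (Z.to_nat c) n) = c ^ Z.of_nat n).
  { induction n as [| n IH]; [reflexivity |].
    rewrite ssrnat.expnS, Nat2Z.inj_succ, Z.pow_succ_r, <- IH by lia.
    change (ssrnat.muln ?x ?y) with (x * y)%nat; lia. }
  specialize (E3 (Z.to_nat p)); rewrite Z2Nat.id in E3 by lia; rewrite <- E3.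
  rewrite F in E1; revert E1 E2.
  (* By [F] both divisions leave the same remainder [m], so the difference is [(v - u) * p];
     abstracting the terms makes this linear for [lia]. *)
  generalize (div.modn (Z.to_nat c) (Z.to_nat p)) as m.
  generalize (div.divn (Z.to_nat c) (Z.to_nat p)) as u.
  generalize (div.divn (ssrnat.expn (Z.to_nat c) (Z.to_nat p)) (Z.to_nat p)) as v.
  intros v u m E1 E2.
  change (ssrnat.expn (Z.to_nat c) (Z.to_nat p) = v * Z.to_nat p + m)%nat in E1.
  change (Z.to_nat c = u * Z.to_nat p + m)%nat in E2.
  rewrite E1; exists (Z.of_nat v - Z.of_nat u).
  lia.
Qed.

(** * Pocklington's criterion *)

Lemma pow_mod_1_mul c i j r : 1 < r -> 0 <= i -> 0 <= j ->
  c ^ i mod r = 1 -> c ^ (i * j) mod r = 1.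
Proof.
  intros Hr Hi Hj H; rewrite Z.pow_mul_r, Zpower_mod, H by lia.
  rewrite Z.pow_1_l, Z.mod_1_l; lia.
Qed.

Lemma pow_mod_1_coprime c i j r : 1 < r -> 0 < i -> 0 < j -> rel_prime i j ->
  c ^ i mod r = 1 -> c ^ j mod r = 1 -> c mod r = 1.
Proof.
  intros Hr Hi Hj C H1 H2.
  destruct (rel_prime_bezout _ _ C) as [u v E].
  (* The Bezout coefficients may be negative; shifting by multiples of [k] turns [u * i + v * j = 1]
     into an identity between nonnegative exponents. *)
  set (k := Z.abs u + Z.abs v).
  assert (K1 : 0 <= u + k * j) by nia.
  assert (K2 : 0 <= k * i - v) by nia.
  apply (pow_mod_1_mul _ _ (u + k * j)) in H1; try lia.
  apply (pow_mod_1_mul _ _ (k * i - v)) in H2; try lia.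
  replace (i * (u + k * j)) with (1 + j * (k * i - v)) in H1 by lia.
  rewrite Z.pow_add_r, Z.mul_mod, H2, Z.mul_1_r, Z.mod_mod, Z.pow_1_r in H1 by nia.
  exact H1.
Qed.

(* Otherwise [p] and [r - 1] are coprime exponents killing
   [2 ^ ((n - 1) / p)] modulo [r], so this power is [1] modulo [r]. *)
Lemma pocklington_divides n p r : prime p -> prime r -> (r | n) -> (p | n - 1) -> 2 < n ->
  2 ^ (n - 1) mod n = 1 -> rel_prime (2 ^ ((n - 1) / p) mod n - 1) n ->
  (p | r - 1).
Proof.
  intros Hp Hr [k Hk] [m Hm] Hn H1 H2.
  assert (Gp := prime_ge_2 _ Hp); assert (Gr := prime_ge_2 _ Hr).
  rewrite Hm, Z.div_mul in H2 by lia.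
  assert (M : forall z, (z mod n) mod r = z mod r).
  { intros z; rewrite (Z.div_mod z n) at 2 by lia.
    rewrite Hk at 2.
    replace (k * r * (z / n) + z mod n) with (z mod n + (k * (z / n)) * r) by ring.
    now rewrite Z.mod_add by lia. }
  assert (H1r : 2 ^ (n - 1) mod r = 1) by (rewrite <- M, H1, Z.mod_1_l; lia).
  destruct (Zdivide_dec p (r - 1)) as [D | D]; [exact D | exfalso].
  assert (Rp : rel_prime p (r - 1)) by now apply prime_rel_prime.
  assert (Hm0 : 0 < m) by nia.
  assert (F : 2 ^ (r - 1) mod r = 1).
  (* [r = 2] is excluded because a positive power of [2] is not [1] modulo [2]. *)
  { assert (N2 : ~ (r | 2)).
    { intros D2; assert (r = 2) by (apply Z.divide_pos_le in D2; lia); subst r.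
      rewrite <- (Z.succ_pred (n - 1)), Z.pow_succ_r, Z.mul_comm, Z.mod_mul in H1r by lia; lia. }
    assert (Dr := fermat_little_Z r 2 Hr ltac:(lia)).
    replace (2 ^ r - 2) with (2 * (2 ^ (r - 1) - 1)) in Dr.
    2: { replace (2 ^ r) with (2 ^ Z.succ (r - 1)) by (f_equal; lia).
         rewrite Z.pow_succ_r by lia; ring. }
    apply prime_mult in Dr; [| exact Hr]; destruct Dr as [Dr | [w Dr]]; [tauto |].
    replace (2 ^ (r - 1)) with (1 + w * r) by lia.
    rewrite Z.mod_add, Z.mod_1_l; lia. }
  assert (C : 2 ^ m mod r = 1).
  { apply (pow_mod_1_coprime _ p (r - 1)); try lia; auto.
    - rewrite <- Z.pow_mul_r, <- Hm by lia; exact H1r.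
    - rewrite <- Z.pow_mul_r, Z.mul_comm by lia; apply pow_mod_1_mul; lia. }
  rewrite <- M in C.
  assert (R : (r | 1)).
  { destruct H2 as [_ _ H2]; apply H2; [| exists k; exact Hk].
    exists ((2 ^ m mod n) / r); rewrite (Z.div_mod (2 ^ m mod n) r) at 1 by lia; lia. }
  apply Z.divide_1_r in R; lia.
Qed.

Lemma prime_divisor n : 1 < n -> exists r, prime r /\ (r | n).
Proof.
  intros Hn; generalize Hn; pattern n; apply Z_lt_induction; [| lia].
  clear n Hn; intros n IH Hn.
  destruct (prime_dec n) as [P | P]; [exists n; split; [exact P | apply Z.divide_refl] |].
  destruct (not_prime_divide n Hn P) as (d & Hd & D).
  destruct (IH d ltac:(lia) ltac:(lia)) as (r & Hr & Dr).
  exists r; split; [exact Hr | eapply Z.divide_trans; eauto].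
Qed.

(** In a factorization [n = e * d], a prime factor of the smaller cofactor has square at most
    [n]. *)
Lemma prime_of_large_divisors n : 1 < n ->
  (forall r, prime r -> (r | n) -> n < r * r) -> prime n.
Proof.
  intros Hn H; destruct (prime_dec n) as [P | P]; [exact P | exfalso].
  destruct (not_prime_divide n Hn P) as (d & Hd & [e E]).
  assert (He : 1 < e < n) by nia.
  destruct (prime_divisor d ltac:(lia)) as (r & Hr & D1).
  destruct (prime_divisor e ltac:(lia)) as (s & Hs & D2).
  assert (B1 := H r Hr ltac:(rewrite E; now apply Z.divide_mul_r)).
  assert (B2 := H s Hs ltac:(rewrite E; now apply Z.divide_mul_l)).
  apply Z.divide_pos_le in D1, D2; [| lia ..].
  apply prime_ge_2 in Hr, Hs.
  destruct (Z.le_ge_cases d e) as [C | C].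
  - assert (r * r <= d * d) by nia; assert (d * d <= e * d) by nia; lia.
  - assert (s * s <= e * e) by nia; assert (e * e <= e * d) by nia; lia.
Qed.

Fixpoint pairwise_coprime (ps : list Z) : bool :=
  match ps with
  | nil => true
  | p :: ps => ((Z.gcd p (fold_right Z.mul 1 ps) =? 1) && pairwise_coprime ps)%bool
  end.

Lemma prod_divides ps m : pairwise_coprime ps = true ->
  (forall p, In p ps -> (p | m)) -> (fold_right Z.mul 1 ps | m).
Proof.
  induction ps as [| p ps IH]; intros C H; [apply Z.divide_1_l |]; simpl in *.
  apply Bool.andb_true_iff in C; destruct C as [C1 C2]; apply Z.eqb_eq in C1.
  destruct (IH C2) as [k E]; [auto |].
  assert (D : (p | m)) by auto.
  rewrite E, Z.mul_comm in D; apply Gauss in D; [| now apply Zgcd_1_rel_prime].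
  rewrite E; now apply Z.mul_divide_mono_r.
Qed.

(** [f] is the factored part of [n - 1], each prime of [ps] entering once; it must exceed the square
    root of [n]. *)
Definition pocklington_check (n : Z) (ps : list Z) : bool :=
  let f := fold_right Z.mul 1 ps in
  ((2 <? n) && (0 <? f) && (n <? f * f) && (Zpow_mod 2 (n - 1) n =? 1) &&
   pairwise_coprime ps &&
   forallb (fun p => ((n - 1) mod p =? 0) &&
     (Z.gcd (Zpow_mod 2 ((n - 1) / p) n - 1) n =? 1)) ps)%bool.

(** Every prime divisor [r] of [n] is [1] modulo each prime in [ps], hence modulo their product [f];
    so [r > f] and [r * r > n]. *)
Lemma pocklington n ps :
  Forall prime ps -> pocklington_check n ps = true -> prime n.
Proof.
  intros Hp H; unfold pocklington_check in H; rewrite Forall_forall in Hp.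
  rewrite !Bool.andb_true_iff in H; destruct H as [[[[[H1 H2] H3] H4] H5] H6].
  apply Z.ltb_lt in H1, H2, H3; apply Z.eqb_eq in H4.
  rewrite Zpow_mod_correct in H4 by lia.
  apply prime_of_large_divisors; [lia |]; intros r Hr Dr.
  assert (D : (fold_right Z.mul 1 ps | r - 1)).
  { apply prod_divides; [exact H5 |]; intros p Ip.
    rewrite forallb_forall in H6; specialize (H6 p Ip).
    apply Bool.andb_true_iff in H6; destruct H6 as [H6 H7].
    apply Z.eqb_eq in H6, H7; rewrite Zpow_mod_correct in H7 by lia.
    assert (Gp := prime_ge_2 _ (Hp p Ip)).
    apply (pocklington_divides n p r); auto.
    - apply Z.mod_divide; lia.
    - now apply Zgcd_1_rel_prime. }
  assert (Gr := prime_ge_2 _ Hr).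
  apply Z.divide_pos_le in D; nia.
Qed.

(** * Trial division and chains of primality certificates *)

Definition small_prime_check (p : Z) : bool :=
  ((1 <? p) &&
   forallb (fun d => negb (p mod Z.of_nat d =? 0)) (seq 2 (Z.to_nat p - 2)))%bool.

Lemma small_prime p : small_prime_check p = true -> prime p.
Proof.
  unfold small_prime_check; intros H; apply Bool.andb_true_iff in H; destruct H as [H1 H].
  apply Z.ltb_lt in H1; apply prime_alt; split; [lia |].
  intros d Hd D; apply Zdivide_mod in D.
  rewrite forallb_forall in H.
  specialize (H (Z.to_nat d)); rewrite Z2Nat.id, D in H by lia.
  discriminate H; apply in_seq; lia.
Qed.

Ltac prime_by_trial := apply small_prime; vm_compute; reflexivity.

(* An entry [(n, ps)] certifies [n] by Pocklington's criterion from the primes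
   [ps], each of which is small or certified by an earlier entry. The test is
   an [if] because [vm_compute] evaluates both arguments of [orb]. *)
Fixpoint chain_check (known : list Z) (chain : list (Z * list Z)) : bool :=
  match chain with
  | nil => true
  | (n, ps) :: chain =>
      (forallb (fun p => if existsb (Z.eqb p) known then true else small_prime_check p) ps &&
       pocklington_check n ps && chain_check (n :: known) chain)%bool
  end.

Lemma chain_check_prime chain known :
  Forall prime known -> chain_check known chain = true ->
  Forall prime (map fst chain).
Proof.
  revert known; induction chain as [| [n ps] chain IH]; intros known K H; simpl in *.
  - constructor.
  - rewrite !Bool.andb_true_iff in H; destruct H as [[H1 H2] H3].
    assert (Hn : prime n).
    { apply (pocklington n ps); [| exact H2].
      rewrite Forall_forall in K |- *; rewrite forallb_forall in H1.
      intros p Ip; specialize (H1 p Ip).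
      destruct (existsb (Z.eqb p) known) eqn:X; [| now apply small_prime].
      apply existsb_exists in X; destruct X as (q & Iq & E).
      apply Z.eqb_eq in E; subst q; auto. }
    constructor; [exact Hn | apply (IH (n :: known)); auto].
Qed.

(** * Walks split into multiplicative and additive steps *)

Definition prime_step (x y : Z) : Prop :=
  exists p, prime p /\ (x = p * y \/ y = p * x).

(** The indices count multiplicative and additive steps, in this order. Vertices range over all of
    [Z]: this only admits more walks, which is harmless for a lower bound. *)
Inductive mixed_walk : nat -> nat -> Z -> Z -> Prop :=
| mixed_nil x : mixed_walk 0 0 x x
| mixed_add t s x y z :
    Z.abs (x - y) = 1 -> mixed_walk t s y z -> mixed_walk t (S s) x z
| mixed_mul t s x y z :
    prime_step x y -> mixed_walk t s y z -> mixed_walk (S t) s x z.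

Lemma adjG_cases (x y : positive) :
  adjG x y -> Z.abs (Z.pos x - Z.pos y) = 1 \/ prime_step (Z.pos x) (Z.pos y).
Proof.
  intros [H | [p [Hp H]]]; [now left | right; exists p; split; [exact Hp |]].
  rewrite Pos2Z.inj_max, Pos2Z.inj_min in H; lia.
Qed.

Lemma walk_mixed (x y : positive) (n : nat) :
  walk G x y n -> exists t s, (t + s = n)%nat /\ mixed_walk t s (Z.pos x) (Z.pos y).
Proof.
  intros W; induction W as [x | x y z n Hxy _ [t [s [E IH]]]].
  - exists 0%nat, 0%nat; split; [reflexivity | constructor].
  - destruct (adjG_cases _ _ Hxy) as [H | H].
    + exists t, (S s); split; [lia | econstructor; eassumption].
    + exists (S t), s; split; [lia | econstructor; eassumption].
Qed.

Lemma mixed_walk_first_add t s x z :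
  mixed_walk t (S s) x z ->
  exists t1 t2 y1 y2, (t1 + t2 = t)%nat /\ mixed_walk t1 0 x y1 /\
    Z.abs (y1 - y2) = 1 /\ mixed_walk t2 s y2 z.
Proof.
  remember (S s) as s' eqn:Es; intros W; revert s Es.
  induction W as [x | t s' x y z H W _ | t s' x y z H W IH]; intros s Es.
  - discriminate.
  - injection Es as ->; exists 0%nat, t, x, y; repeat split; auto; constructor.
  - destruct (IH s Es) as (t1 & t2 & y1 & y2 & E & W1 & A & W2).
    exists (S t1), t2, y1, y2; repeat split; auto; [lia | econstructor; eassumption].
Qed.

Lemma mixed_walk_first_mul t s x z :
  mixed_walk (S t) s x z ->
  exists s1 s2 y1 y2, (s1 + s2 = s)%nat /\ Z.abs (x - y1) <= Z.of_nat s1 /\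
    prime_step y1 y2 /\ mixed_walk t s2 y2 z.
Proof.
  remember (S t) as t' eqn:Et; intros W; revert t Et.
  induction W as [x | t' s x y z H W IH | t' s x y z H W _]; intros t Et.
  - discriminate.
  - destruct (IH t Et) as (s1 & s2 & y1 & y2 & E & A & S & W2).
    exists (Datatypes.S s1), s2, y1, y2; repeat split; auto; lia.
  - injection Et as ->; exists 0%nat, s, x, y; repeat split; auto; lia.
Qed.

Lemma mixed_walk_additive s x y : mixed_walk 0 s x y -> Z.abs (x - y) <= Z.of_nat s.
Proof.
  remember 0%nat as t eqn:Et; intros W; revert Et.
  induction W; intros Et; [lia | specialize (IHW Et); lia | discriminate].
Qed.

(** * Prime powers along multiplicative steps *)

Lemma prime_step_sym x y : prime_step x y -> prime_step y x.
Proof. intros [p [Hp H]]; exists p; tauto. Qed.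

(** Dividing by [p] cancels one factor [p], dividing by another prime [q] cancels none since [q] is
    coprime to the power of [p], and multiplying loses nothing. *)
Lemma prime_step_dvd p n x y :
  prime p -> prime_step x y -> (p ^ Z.of_nat n | x) -> (p ^ Z.of_nat (n - 1) | y).
Proof.
  intros Hp [q [Hq H]] D.
  (* For [n = 0] the truncated exponent is [0], and [1] divides everything. *)
  destruct n as [| n]; [exists y; simpl; lia |].
  replace (S n - 1)%nat with n by lia.
  rewrite Nat2Z.inj_succ, Z.pow_succ_r in D by lia.
  destruct H as [-> | ->].
  - destruct (Zdivide_dec p q) as [Hd | Hd].
    + apply prime_div_prime in Hd; auto; subst q.
      apply Z.mul_divide_cancel_l in D; [exact D | destruct Hp; lia].
    + apply Gauss with q.
      * apply Z.divide_trans with (2 := D); apply Z.divide_factor_r.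
      * apply rel_prime_sym, rel_prime_Zpower_r; [lia |].
        apply rel_prime_sym, prime_rel_prime; auto.
  - apply Z.divide_mul_r, Z.divide_trans with (2 := D), Z.divide_factor_r.
Qed.

Lemma mixed_walk_dvd_l p n t x y :
  prime p -> mixed_walk t 0 x y ->
  (p ^ Z.of_nat n | x) -> (p ^ Z.of_nat (n - t) | y).
Proof.
  intros Hp; remember 0%nat as s eqn:Es; intros W; revert n Es.
  induction W as [x | t s x y z H W _ | t s x y z H W IH]; intros n Es D.
  - now rewrite Nat.sub_0_r.
  - discriminate.
  - replace (n - S t)%nat with (n - 1 - t)%nat by lia.
    apply IH; auto; eapply prime_step_dvd; eauto.
Qed.

Lemma mixed_walk_dvd_r p n t x y :
  prime p -> mixed_walk t 0 x y ->
  (p ^ Z.of_nat n | y) -> (p ^ Z.of_nat (n - t) | x).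
Proof.
  intros Hp; remember 0%nat as s eqn:Es; intros W; revert Es.
  induction W as [x | t s x y z H W _ | t s x y z H W IH]; intros Es D.
  - now rewrite Nat.sub_0_r.
  - discriminate.
  - replace (n - S t)%nat with (n - t - 1)%nat by lia.
    apply prime_step_dvd with y; auto using prime_step_sym.
Qed.

Lemma dvd_pow_base p n x : (0 < n)%nat -> (p ^ Z.of_nat n | x) -> (p | x).
Proof.
  intros Hn D; apply Z.divide_trans with (2 := D).
  destruct n as [| n]; [lia |].
  rewrite Nat2Z.inj_succ, Z.pow_succ_r by lia; apply Z.divide_factor_l.
Qed.

Lemma mixed_walk_dvd_base_l n p t x y :
  (t < n)%nat -> prime p -> mixed_walk t 0 x y -> (p ^ Z.of_nat n | x) -> (p | y).
Proof.
  intros Hn Hp W D; apply dvd_pow_base with (n - t)%nat; [lia |].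
  eapply mixed_walk_dvd_l; eauto.
Qed.

Lemma mixed_walk_dvd_base_r n p t x y :
  (t < n)%nat -> prime p -> mixed_walk t 0 x y -> (p ^ Z.of_nat n | y) -> (p | x).
Proof.
  intros Hn Hp W D; apply dvd_pow_base with (n - t)%nat; [lia |].
  eapply mixed_walk_dvd_r; eauto.
Qed.

(** * Lower bound: at most two additive steps *)

Ltac dvd_by_mod := apply Z.mod_divide; [lia | vm_compute; reflexivity].
Ltac ndvd_by_mod :=
  let H := fresh in intros H; apply Zdivide_mod in H; vm_compute in H; discriminate H.

Local Notation A := (Z.pos a).
Local Notation B := (Z.pos b).

Lemma no_walk_0 t : (t <= 5)%nat -> ~ mixed_walk t 0 A B.
Proof.
  intros Ht W.
  assert (D : (5 | B)).
  { apply (mixed_walk_dvd_base_l 6 5 t A); [lia | prime_by_trial | exact W | dvd_by_mod]. }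
  revert D; ndvd_by_mod.
Qed.

(** [3 ^ 5] divides both [A] and [B], so both ends of the only additive step would be multiples of
    [3]. *)
Lemma no_walk_1 t : (t <= 4)%nat -> ~ mixed_walk t 1 A B.
Proof.
  intros Ht W.
  destruct (mixed_walk_first_add _ _ _ _ W) as (l & n & x & y & E & W1 & H & W2).
  assert (Hp : prime 3) by prime_by_trial.
  destruct (mixed_walk_dvd_base_l 5 3 l A x) as [u Hu]; [lia | auto | auto | dvd_by_mod |].
  destruct (mixed_walk_dvd_base_r 5 3 n y B) as [v Hv]; [lia | auto | auto | dvd_by_mod |].
  lia.
Qed.

(** Each step removes at most one factor [p], so losing all of them in [t] steps forces every step
    to be a division by [p]. *)
Lemma mixed_walk_all_cancel p t x y :
  prime p -> mixed_walk t 0 x y -> (p ^ Z.of_nat t | x) -> ~ (p | y) ->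
  x = p ^ Z.of_nat t * y.
Proof.
  intros Hp; remember 0%nat as s eqn:Es; intros W; revert Es.
  induction W as [x | t s x y z H W _ | t s x y z H W IH]; intros Es D N.
  - lia.
  - discriminate.
  - subst s.
    assert (Dy : (p ^ Z.of_nat t | y)).
    { replace t with (S t - 1)%nat by lia; eapply prime_step_dvd; eauto. }
    assert (Ny : ~ (p ^ Z.of_nat (S t) | y)).
    { intros D'; apply N; eapply mixed_walk_dvd_base_l; eauto. }
    rewrite (IH eq_refl Dy N) in *; clear IH Dy.
    destruct H as [q [Hq [E | E]]]; [| now destruct Ny; rewrite E; apply Z.divide_mul_r].
    destruct (Zdivide_dec p q) as [Hd | Hd].
    + apply prime_div_prime in Hd; auto; subst q.
      rewrite Nat2Z.inj_succ, Z.pow_succ_r, E by lia; ring.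
    + destruct Ny; apply Gauss with q; [rewrite <- E; exact D |].
      apply rel_prime_sym, rel_prime_Zpower_r; [lia |].
      apply rel_prime_sym, prime_rel_prime; auto.
Qed.

Lemma mixed_walk_nil x y : mixed_walk 0 0 x y -> x = y.
Proof. intros W; apply mixed_walk_additive in W; lia. Qed.

Lemma mixed_walk_single x y : mixed_walk 1 0 x y -> prime_step x y.
Proof.
  intros W; destruct (mixed_walk_first_mul _ _ _ _ W) as (s1 & s2 & u & v & E & H & S & W2).
  replace s2 with 0%nat in W2 by lia; apply mixed_walk_nil in W2; subst v.
  now replace x with u by lia.
Qed.

Lemma even_prime p : prime p -> (2 | p) -> p = 2.
Proof. intros Hp D; symmetry; apply prime_div_prime; auto using prime_2. Qed.

Ltac pull_l n p W H :=
  lazymatch type of W with mixed_walk ?t 0 ?x ?y =>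
    assert (H : (p | y)) by
      (apply (mixed_walk_dvd_base_l n p t x y);
        [lia | prime_by_trial | exact W | dvd_by_mod])
  end.
Ltac pull_r n p W H :=
  lazymatch type of W with mixed_walk ?t 0 ?x ?y =>
    assert (H : (p | x)) by
      (apply (mixed_walk_dvd_base_r n p t x y);
        [lia | prime_by_trial | exact W | dvd_by_mod])
  end.
Ltac non_divisor D := exfalso; revert D; ndvd_by_mod.

Lemma abs_1 x y : Z.abs (x - y) = 1 -> y = x - 1 \/ y = x + 1.
Proof. lia. Qed.

Lemma consecutive_coprime p x y :
  1 < p -> (p | x) -> (p | y) -> Z.abs (x - y) = 1 -> False.
Proof.
  intros Hp Hx Hy H.
  assert (D : (p | Z.abs (x - y))) by (apply Z.divide_abs_r; now apply Z.divide_sub_r).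
  rewrite H in D; apply Z.divide_1_r in D; lia.
Qed.

Lemma no_mul_walk_between_neighbours (x' y' : Z) :
  Z.abs (A - x') = 1 -> Z.abs (y' - B) = 1 -> ~ mixed_walk 3 0 x' y'.
Proof.
  intros HA HB W; apply abs_1 in HA.
  assert (E : y' = B - 1 \/ y' = B + 1) by lia; clear HB.
  destruct E as [-> | ->].
  - pull_r 7%nat 5 W D; destruct HA as [-> | ->]; non_divisor D.
  - destruct HA as [-> | ->].
    + (* All three steps would have to divide by [11]. *)
      assert (E : A - 1 = 11 ^ Z.of_nat 3 * (B + 1)); [| discriminate E].
      apply mixed_walk_all_cancel; auto; [prime_by_trial | dvd_by_mod | ndvd_by_mod].
    + pull_r 4%nat 59 W D; non_divisor D.
Qed.

Lemma no_alternating_walk x x' y' y :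
  prime_step A x -> Z.abs (x - x') = 1 -> prime_step x' y' ->
  Z.abs (y' - y) = 1 -> prime_step y B -> False.
Proof.
  intros S1 H1 S2 H2 S3.
  assert (W1 : mixed_walk 1 0 A x) by (econstructor; [eassumption | constructor]).
  assert (W2 : mixed_walk 1 0 x' y') by (econstructor; [eassumption | constructor]).
  assert (W3 : mixed_walk 1 0 y B) by (econstructor; [eassumption | constructor]).
  pull_l 2%nat 2 W1 X2.
  assert (X'2 : ~ (2 | x')) by (intros D; eapply consecutive_coprime in H1; eauto; lia).
  (* As [B] is odd, an even [y] can only arise by cancelling the prime [2]. *)
  assert (Y : y = 2 * B \/ ~ (2 | y)).
  { destruct S3 as [q [Hq [E | E]]].
    - destruct (Zdivide_dec 2 q) as [D | D].
      + left; rewrite (even_prime q Hq D) in E; exact E.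
      + right; intros D'; rewrite E in D'; apply prime_mult in D'; [| exact prime_2].
        destruct D' as [D' | D']; [tauto | non_divisor D'].
    - right; intros D; assert (D' : (2 | B)) by (rewrite E; now apply Z.divide_mul_r).
      non_divisor D'. }
  destruct Y as [-> | Y].
  - assert (E : y' = 2 * B - 1 \/ y' = 2 * B + 1) by lia.
    destruct E as [-> | ->].
    + pull_r 3%nat 61 W2 D; pull_l 3%nat 61 W1 D'.
      eapply consecutive_coprime in H1; eauto; lia.
    + pull_r 3%nat 67 W2 D; pull_l 3%nat 67 W1 D'.
      eapply consecutive_coprime in H1; eauto; lia.
  - assert (Y' : (2 | y')).
    { apply Zmod_divide; [lia |].
      destruct (Z.eq_dec (y mod 2) 0) as [E | E].
      - destruct Y; apply Zmod_divide; [lia | exact E].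
      - Z.div_mod_to_equations; lia. }
    (* With [x'] odd and [y'] even the middle step is [y' = 2 * x']; but [x'] and [y'] are both [1]
       or [-1] modulo [17]. *)
    pull_l 3%nat 17 W1 D1; pull_r 3%nat 17 W3 D3; destruct D1 as [u Hu], D3 as [v Hv].
    destruct S2 as [p [Hp [E | E]]].
    + destruct X'2; rewrite E; now apply Z.divide_mul_r.
    + rewrite E in Y'; apply prime_mult in Y'; [| exact prime_2].
      destruct Y' as [D | D]; [| tauto].
      rewrite (even_prime p Hp D) in E; lia.
Qed.

Lemma no_walk_2 t : (t <= 3)%nat -> ~ mixed_walk t 2 A B.
Proof.
  intros Ht W.
  destruct (mixed_walk_first_add _ _ _ _ W) as (l & t' & x & x' & E & W1 & H1 & W').
  destruct (mixed_walk_first_add _ _ _ _ W') as (m & n & y' & y & E' & W2 & H2 & W3).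
  destruct m as [| m].
  (* Adjacent additive steps: [x] and [y] are multiples of [3] at distance at most [2], so they
     agree, and what remains is a purely multiplicative walk, refuted by [5] as before. *)
  { apply mixed_walk_nil in W2; subst y'.
    pull_l 5%nat 3 W1 D1; pull_r 5%nat 3 W3 D3; destruct D1 as [u Hu], D3 as [v Hv].
    assert (Exy : y = x) by lia; rewrite Exy in W3.
    assert (H5 : prime 5) by prime_by_trial.
    assert (D : (5 ^ Z.of_nat 6 | A)) by dvd_by_mod.
    apply (mixed_walk_dvd_l 5 _ _ _ _ H5 W1), (mixed_walk_dvd_l 5 _ _ _ _ H5 W3),
      dvd_pow_base in D; [non_divisor D | lia]. }
  destruct n as [| n].
  { apply mixed_walk_nil in W3; subst y.
    assert (C : l = 0%nat /\ m = 2%nat \/ (S m <= 2)%nat) by lia.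
    destruct C as [[-> ->] | C].
    - apply mixed_walk_nil in W1; subst x.
      exact (no_mul_walk_between_neighbours x' y' H1 H2 W2).
    (* At most two steps lie on each side of the first additive step, so [5] (for [B - 1]) or [13]
       (for [B + 1]) divides both of its ends. *)
    - assert (F : y' = B - 1 \/ y' = B + 1) by lia.
      destruct F as [-> | ->].
      + pull_r 7%nat 5 W2 D; pull_l 6%nat 5 W1 D'.
        eapply consecutive_coprime in H1; eauto; lia.
      + pull_r 3%nat 13 W2 D; pull_l 4%nat 13 W1 D'.
        eapply consecutive_coprime in H1; eauto; lia. }
  destruct l as [| l].
  (* The mirror case: [11] or [7] divides both ends of the second additive step. *)
  { apply mixed_walk_nil in W1; subst x; apply abs_1 in H1.
    destruct H1 as [-> | ->].
    - pull_l 3%nat 11 W2 D; pull_r 3%nat 11 W3 D'.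
      eapply consecutive_coprime in H2; eauto; lia.
    - pull_l 3%nat 7 W2 D; pull_r 3%nat 7 W3 D'.
      eapply consecutive_coprime in H2; eauto; lia. }
  assert (l = 0 /\ m = 0 /\ n = 0)%nat as (-> & -> & ->) by lia.
  eapply no_alternating_walk; eauto using mixed_walk_single.
Qed.

(** * Lower bound: at most two multiplicative steps *)

Lemma no_walk_additive s : (s <= 5)%nat -> ~ mixed_walk 0 s A B.
Proof.
  intros Hs W; apply mixed_walk_additive in W; unfold a, b in W; lia.
Qed.

(** A multiplicative step changes the size by a factor of at least [2], whereas [a / b] lies well
    between [1] and [2]. *)
Lemma no_walk_one_mul s : (s <= 4)%nat -> ~ mixed_walk 1 s A B.
Proof.
  intros Hs W.
  destruct (mixed_walk_first_mul _ _ _ _ W) as (s1 & s2 & x & y & E & H1 & St & W2).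
  apply mixed_walk_additive in W2; unfold a, b in *.
  destruct St as [p [Hp [F | F]]]; apply prime_ge_2 in Hp; nia.
Qed.

Lemma square_dvd_close p x y :
  2 <= p -> (p ^ 2 | x) -> (p ^ 2 | y) -> Z.abs (x - y) <= 3 -> x = y.
Proof.
  intros Hp [u ->] [v ->] H.
  assert (H4 : 4 <= p ^ 2) by nia.
  destruct (Z.eq_dec u v) as [-> | N]; [reflexivity | nia].
Qed.

(** One step leaves [p ^ 2] in both [x'] and [y'], and distinct multiples of [p ^ 2] are at least
    [4] apart. *)
Lemma meet_by_cube p x x' y' y :
  prime p -> prime_step x x' -> prime_step y' y ->
  (p ^ Z.of_nat 3 | x) -> (p ^ Z.of_nat 3 | y) ->
  Z.abs (x' - y') <= 3 -> x' = y'.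
Proof.
  intros Hp S1 S2 D1 D2; apply (square_dvd_close p).
  - now apply prime_ge_2.
  - exact (prime_step_dvd p 3 x x' Hp S1 D1).
  - exact (prime_step_dvd p 3 y y' Hp (prime_step_sym _ _ S2) D2).
Qed.

Lemma mul_walk_2 x y z : prime_step x y -> prime_step y z -> mixed_walk 2 0 x z.
Proof. intros S1 S2; repeat (econstructor; try eassumption). Qed.

Ltac by_cube p S1 S2 :=
  apply (meet_by_cube p _ _ _ _ ltac:(prime_by_trial) S1 S2);
    [dvd_by_mod | dvd_by_mod | lia].
Ltac by_l p W := let D := fresh in pull_l 3%nat p W D; non_divisor D.
Ltac by_r p W := let D := fresh in pull_r 3%nat p W D; non_divisor D.

Lemma no_walk_two_mul s : (s <= 3)%nat -> ~ mixed_walk 2 s A B.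
Proof.
  intros Hs W.
  destruct (mixed_walk_first_mul _ _ _ _ W) as (i & s' & x & x' & E & H1 & S1 & W').
  destruct (mixed_walk_first_mul _ _ _ _ W') as (j & k & y' & y & E' & H2 & S2 & W2).
  apply mixed_walk_additive in W2.
  destruct (Z.eq_dec x' y') as [<- | N].
  (* The two multiplicative steps are joined, from near [A] to near [B]: in each case a prime whose
     cube divides one end fails to divide the other. *)
  - assert (W3 := mul_walk_2 _ _ _ S1 S2); clear S1 S2 W W' H2.
    assert (X : x = A - 3 \/ x = A - 2 \/ x = A - 1 \/ x = A \/ x = A + 1 \/
      x = A + 2 \/ x = A + 3) by lia.
    assert (Y : y = B - 3 \/ y = B - 2 \/ y = B - 1 \/ y = B \/ y = B + 1 \/
      y = B + 2 \/ y = B + 3) by lia.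
    destruct X as [-> | [-> | [-> | [-> | [-> | [-> | ->]]]]]];
      destruct Y as [-> | [-> | [-> | [-> | [-> | [-> | ->]]]]]];
      first [exfalso; lia
        | by_l 5 W3 | by_l 13 W3 | by_l 7 W3 | by_l 11 W3
        | by_r 37 W3 | by_r 13 W3 | by_r 5 W3].
  (* Now an additive step lies between [x'] and [y'], so the two outer offsets total at most [2];
     for each such pair a common cube forces [x' = y']. *)
  - apply N.
    assert (X : x = A - 2 \/ x = A - 1 \/ x = A \/ x = A + 1 \/ x = A + 2) by lia.
    assert (Y : y = B - 2 \/ y = B - 1 \/ y = B \/ y = B + 1 \/ y = B + 2) by lia.
    destruct X as [-> | [-> | [-> | [-> | ->]]]];
      destruct Y as [-> | [-> | [-> | [-> | ->]]]];
      first [exfalso; lia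
        | by_cube 17 S1 S2 | by_cube 5 S1 S2 | by_cube 13 S1 S2 | by_cube 29 S1 S2
        | by_cube 31 S1 S2 | by_cube 11 S1 S2 | by_cube 7 S1 S2 | by_cube 23 S1 S2
        | by_cube 19 S1 S2 | by_cube 53 S1 S2 | by_cube 59 S1 S2
        | by_cube 43 S1 S2 | by_cube 47 S1 S2].
Qed.

Lemma distance_at_least_6 n : walk G a b n -> (6 <= n)%nat.
Proof.
  intros W; destruct (Nat.le_gt_cases 6 n) as [H | H]; [exact H | exfalso].
  destruct (walk_mixed _ _ _ W) as (t & s & E & W'); clear W.
  destruct s as [| [| [| s]]].
  - revert W'; apply no_walk_0; lia.
  - revert W'; apply no_walk_1; lia.
  - revert W'; apply no_walk_2; lia.
  - destruct t as [| [| [| t]]]; [| | | lia].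
    + revert W'; apply no_walk_additive; lia.
    + revert W'; apply no_walk_one_mul; lia.
    + revert W'; apply no_walk_two_mul; lia.
Qed.

(** * Upper bound: certified multipliers and the explicit walk *)

(** Three towers of certificates in succession, whose last entries are the multipliers [p], [q] and
    [r] of the walk. *)
Definition prime_chain : list (Z * list Z) :=
  [(27551, [29; 19]);
   (22040801, [27551]);
   (20251043877199, [22040801]);
   (14823764118109669, [20251043877199]);
   (626176066645866572663127846367, [14823764118109669]);
   (745193558212024160268278773274041059002117737652176363, [626176066645866572663127846367]);
   (91421227, [733; 41]);
   (65449, [101; 3]);
   (69503498322881569, [91421227; 65449]);
   (278013993291526277, [69503498322881569]);
   (3607, [601]);
   (173137, [3607]);
   (418645267, [173137]);
   (7260983510849, [418645267]);
   (132734797185439670668409773434024046335437089163319604403729, [278013993291526277; 7260983510849]);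
   (2450018886448845441197507598045215847259497791776553258084029883, [132734797185439670668409773434024046335437089163319604403729]);
   (193731831091347341748941827958661326641193643584461903262461132082472221774230324810598781251, [2450018886448845441197507598045215847259497791776553258084029883]);
   (11042137, [109; 67]);
   (28864146119, [11042137]);
   (59273, [239; 31]);
   (40305641, [59273]);
   (2825336404748222498257219, [28864146119; 40305641]);
   (295244808839586398237245833206946503227, [2825336404748222498257219])].

Lemma prime_chain_prime n : In n (map fst prime_chain) -> prime n.
Proof.
  revert n; apply Forall_forall, (chain_check_prime _ nil); [constructor |].
  vm_compute; reflexivity.
Qed.

Lemma adjG_mul (p x y : positive) : prime (Z.pos p) -> y = (p * x)%positive -> adjG x y.
Proof.
  intros Hp ->; right; exists (Z.pos p); split; [exact Hp |].
  apply prime_ge_2 in Hp.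
  assert (x <= p * x)%positive by nia.
  rewrite Pos.max_r, Pos.min_l by assumption; reflexivity.
Qed.

Lemma adjG_succ (x : positive) : adjG x (Pos.succ x).
Proof. left; lia. Qed.

(* The two multipliers solve the linear equation [(c - 1) * q + 1 = r * (b - 1)]
   in primes, where [c] is the cofactor in [a] of its largest prime factor. *)
Lemma distance_at_most_6 : walk G a b 6.
Proof.
  set (p := 745193558212024160268278773274041059002117737652176363%positive).
  set (q := 193731831091347341748941827958661326641193643584461903262461132082472221774230324810598781251%positive).
  set (r := 295244808839586398237245833206946503227%positive).
  set (c := 105705954619498329849259302356437500%positive).
  assert (Hp : prime (Z.pos p)) by (apply prime_chain_prime; simpl; tauto).
  assert (Hq : prime (Z.pos q)) by (apply prime_chain_prime; simpl; tauto).
  assert (Hr : prime (Z.pos r)) by (apply prime_chain_prime; simpl; tauto).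
  set (x := Pos.pred c); set (y := (q * x)%positive).
  apply walk_cons with c.
  { apply adjG_sym, (adjG_mul p); [exact Hp | reflexivity]. }
  apply walk_cons with x.
  { apply adjG_sym, (adjG_succ x). }
  apply walk_cons with y.
  { now apply (adjG_mul q). }
  apply walk_cons with (Pos.succ y).
  { apply adjG_succ. }
  apply walk_cons with (Pos.pred b).
  { apply adjG_sym, (adjG_mul r); [exact Hr | reflexivity]. }
  apply walk_cons with b.
  { apply (adjG_succ (Pos.pred b)). }
  constructor.
Qed.

Theorem proposition3p1 : is_dist G a b 6.
Proof.
  split; [exact distance_at_most_6 | exact distance_at_least_6].
Qed.
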